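(* If a diffeological space $X$ is $D$-Hausdorff and $D$-paracompact, then it is $D$-normal.
   Context: A diffeological space is a set $X$ with a family (diffeology) of maps $P:U\to X$ from open subsets $U$ of Euclidean spaces, called plots, such that: constant parametrizations are plots; a parametrization that is a plot in a neighborhood of each point of its domain is a plot; if $P:U\to X$ is a plot and $Q:V\to U$ is a smooth map between open subsets of Euclidean spaces then $P\circ Q$ is a plot. A subset $A \subset X$ is $D$-open (resp. $D$-closed) in $X$ if $P^{-1}(A)$ is open (resp. closed) in $U$ for every plot $P:U\to X$. $X$ is $D$-Hausdorff if any two distinct points have disjoint $D$-open neighborhoods. $X$ is $D$-paracompact if every cover of $X$ by $D$-open sets has a locally finite refinement which is a cover by $D$-open sets, where a family of subsets is locally finite if each point has a $D$-open neighborhood meeting only finitely many members. $X$ is $D$-normal if for any disjoint $D$-closed sets $A,B$ of $X$ there exist disjoint $D$-open sets $U_A\supset A$ and $U_B\supset B$. *)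

(* Defs.v *)
From HB Require Import structures.
From mathcomp Require Import all_boot all_order all_algebra.
From mathcomp Require Import all_classical all_reals all_analysis.

Set Implicit Arguments.
Unset Strict Implicit.
Unset Printing Implicit Defensive.

Import Order.TTheory GRing.Theory Num.Theory.
Import numFieldNormedType.Exports.

Local Open Scope classical_set_scope.
Local Open Scope ring_scope.

(* [C_on k V f]: on the open set [V], all partial derivatives of [f] of order
   at most [k] exist and are continuous. As [V] is open, this depends only on
   the values of [f] on [V]. *)
Fixpoint C_on (R : realType) (m n k : nat) (V : set 'rV[R]_m)
    (f : 'rV[R]_m -> 'rV[R]_n) : Prop :=
  {in V, continuous f} /\
  if k is k'.+1 then
    forall i : 'I_m, (forall x, V x -> derivable f x (delta_mx 0 i)) /\
      C_on k' V ('D_(delta_mx 0 i) f)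
  else True.

(* The derivatives in the library are those of total functions, hence the
   extension [F]; its values outside of the open set [V] are irrelevant. *)
Definition smooth_map (R : realType) (m n : nat) (V : set 'rV[R]_m)
    (U : set 'rV[R]_n) (Q : V -> U) : Prop :=
  exists F : 'rV[R]_m -> 'rV[R]_n,
    (forall v : V, F (set_val v) = set_val (Q v)) /\ forall k, C_on k V F.

Definition restr (T X : Type) (V U : set T) (sVU : V `<=` U) (P : U -> X) :
    V -> X :=
  fun v => P (SigSub (mem_set (sVU (set_val v) (set_valP v)))).

Record diffeologicalSpace (R : realType) := DiffeologicalSpace {
  dcarrier :> Type ;
  plot : forall (n : nat) (U : set 'rV[R]_n), (U -> dcarrier) -> Prop ;
  plot_open : forall (n : nat) (U : set 'rV[R]_n) (P : U -> dcarrier),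
    plot P -> open U ;
  plot_cst : forall (n : nat) (U : set 'rV[R]_n) (x : dcarrier),
    open U -> plot (fun _ : U => x) ;
  plot_local : forall (n : nat) (U : set 'rV[R]_n) (P : U -> dcarrier),
    open U ->
    (forall u : U, exists (V : set 'rV[R]_n) (sVU : V `<=` U),
      [/\ open V, V (set_val u) & plot (restr sVU P)]) ->
    plot P ;
  plot_comp : forall (m n : nat) (V : set 'rV[R]_m) (U : set 'rV[R]_n)
      (P : U -> dcarrier) (Q : V -> U),
    plot P -> open V -> smooth_map Q -> plot (P \o Q)
}.

Section DTopology.
Context {R : realType} {X : diffeologicalSpace R}.
Implicit Types (A B : set X) (C F : set (set X)).

(* A set [U] used as a type carries the subspace topology. *)
Definition D_open A : Prop :=
  forall (n : nat) (U : set 'rV[R]_n) (P : U -> X), plot P -> open (P @^-1` A).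

Definition D_closed A : Prop :=
  forall (n : nat) (U : set 'rV[R]_n) (P : U -> X), plot P ->
    closed (P @^-1` A).

Definition D_open_cover C : Prop :=
  (forall A, C A -> D_open A) /\ \bigcup_(A in C) A = setT.

Definition refines F C : Prop :=
  forall B, F B -> exists2 A, C A & B `<=` A.

Definition D_locally_finite F : Prop :=
  forall x : X, exists W : set X,
    [/\ D_open W, W x & finite_set [set B | F B /\ B `&` W !=set0]].

End DTopology.

Section DProperties.
Context {R : realType} (X : diffeologicalSpace R).

Definition D_Hausdorff : Prop :=
  forall x y : X, x <> y -> exists A B : set X,
    [/\ D_open A, D_open B, A x, B y & A `&` B = set0].

Definition D_paracompact : Prop :=
  forall C : set (set X), D_open_cover C ->
    exists F : set (set X),
      [/\ D_open_cover F, refines F C & D_locally_finite F].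

Definition D_normal : Prop :=
  forall A B : set X, D_closed A -> D_closed B -> A `&` B = set0 ->
    exists UA UB : set X,
      [/\ D_open UA, D_open UB, A `<=` UA, B `<=` UB & UA `&` UB = set0].

End DProperties.

(* Main.v *)
(** The D-open sets form a topology, and the classical argument applies to it.
    Let [A] be D-closed with every point of [A] separated from [B]. Cover [X]
    by the complement of [A] and the D-open sets separated from [B], and take
    a locally finite refinement: the union [UA] of its members meeting [A] is
    separated from [B], because a point of [B] has a neighborhood meeting only
    finitely many of these members, each of which is separated from [B].
    Applying this to points gives regularity, and applying it again gives
    normality. *)
Require Import Defs.
From mathcomp Require Import all_boot all_order all_algebra.
From mathcomp Require Import all_classical all_reals all_analysis.

Set Implicit Arguments.
Unset Strict Implicit.
Unset Printing Implicit Defensive.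

Local Open Scope classical_set_scope.

Section DTopologyTheory.
Context {R : realType} {X : diffeologicalSpace R}.
Implicit Types (A B : set X) (C F : set (set X)).

Lemma D_open_bigcup I (D : set I) (G : I -> set X) :
  (forall i, D i -> D_open (G i)) -> D_open (\bigcup_(i in D) G i).
Proof.
move=> GO n U P plotP; rewrite preimage_bigcup.
by apply: bigcup_open => i Di; exact: GO.
Qed.

Lemma D_openI A B : D_open A -> D_open B -> D_open (A `&` B).
Proof.
move=> AO BO n U P plotP; rewrite preimage_setI.
by apply: openI; [exact: AO|exact: BO].
Qed.

Lemma D_open_bigcap (I : choiceType) (D : set I) (G : I -> set X) :
  finite_set D -> (forall i, D i -> D_open (G i)) ->
  D_open (\bigcap_(i in D) G i).
Proof.
move=> finD GO n U P plotP; rewrite -closedC preimage_bigcap setC_bigcap.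
by apply: closed_bigcup => // i Di; apply: open_closedC; exact: GO.
Qed.

Lemma D_openC A : D_closed A -> D_open (~` A).
Proof.
by move=> clA n U P plotP; rewrite preimage_setC; apply: closed_openC; exact: clA.
Qed.

Lemma D_paracompact_separation A B :
  D_paracompact X -> D_closed A ->
  (forall x, A x -> exists U V : set X,
    [/\ D_open U, D_open V, U x, B `<=` V & U `&` V = set0]) ->
  exists UA UB : set X,
    [/\ D_open UA, D_open UB, A `<=` UA, B `<=` UB & UA `&` UB = set0].
Proof.
move=> pX clA sepAB.
pose far (U : set X) := exists V : set X,
  [/\ D_open V, B `<=` V & U `&` V = set0].
pose C := [set U | D_open U /\ far U] `|` [set ~` A].
have [|F [[FO Fcover] FC Ffin]] := pX C.
  split=> [U [[]//|->]|]; first exact: D_openC.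
  rewrite -subTset => x _.
  have [/sepAB[U [V [UO VO Ux BV UV0]]]|nAx] := pselect (A x).
    by exists U => //; left; split=> //; exists V.
  by exists (~` A) => //; right.
pose FA := [set G | F G /\ G `&` A !=set0].
(* A member of [F] meeting [A] cannot lie in the complement of [A], so it lies in a far set and
   inherits that set's neighborhood of [B]. *)
have FAfar G : FA G -> far G.
  move=> [/FC[U [[UO [V [VO BV UV0]]]|->] GU] [x [Gx Ax]]].
    by exists V; split=> //; rewrite -subset0 -UV0; exact: setSI.
  by case: (GU x Gx).
have [V VP] : {V : set X -> set X & forall G, FA G ->
    [/\ D_open (V G), B `<=` V G & G `&` V G = set0]}.
  apply: (@choice _ _ (fun G W => FA G ->
    [/\ D_open W, B `<=` W & G `&` W = set0])) => G.
  have [/FAfar[W ?]|?] := pselect (FA G); first by exists W.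
  by exists set0.
pose UA := \bigcup_(G in FA) G.
(* The second witness is the D-interior of the complement of [UA]: each point of [B] only needs one
   D-open neighborhood missing [UA]. *)
exists UA, (\bigcup_(O in [set O | D_open O /\ UA `&` O = set0]) O); split.
- by apply: D_open_bigcup => G [/FO].
- by apply: D_open_bigcup => O [].
- move=> x Ax; have [G FG Gx] : (\bigcup_(G in F) G) x by rewrite Fcover.
  by exists G => //; split=> //; exists x.
- move=> b Bb; have [W [WO Wb finW]] := Ffin b.
  pose D := [set G | FA G /\ G `&` W !=set0].
  have finD : finite_set D.
    by apply: sub_finite_set finW => G [[FG _] GW].
  (* [W] misses the members of [FA] outside [D]; [V G] misses each of the finitely many [G] in
     [D]. *)
  exists (W `&` \bigcap_(G in D) V G).
    split.
      apply: D_openI => //; apply: D_open_bigcap => // G [/VP[]//].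
    rewrite -subset0 => x [[G FAG Gx] [Wx Vx]].
    have [_ _ <-] := VP G FAG; split=> //; apply: Vx.
    by split=> //; exists x.
  by split=> // G [/VP[_ BV _] _]; exact: BV.
- by rewrite -subset0 => x [UAx [W [_ <-] Wx]].
Qed.

End DTopologyTheory.

Theorem theorem2p14 (R : realType) (X : diffeologicalSpace R) :
  D_Hausdorff X -> D_paracompact X -> D_normal X.
Proof.
move=> hX pX A B clA clB AB0.
apply: D_paracompact_separation => // x Ax.
have nBx : ~ B x by move=> Bx; rewrite -[False]/(set0 x) -AB0.
(* Regularity: [B] is now the D-closed set, and the Hausdorff property separates its points from
   [x]. *)
have [|U [V [UO VO BU xV UV0]]] :=
  @D_paracompact_separation _ _ B [set x] pX clB.
  move=> y By; have [|U [V [UO VO Uy Vx UV0]]] := hX y x.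
    by move=> yx; apply: nBx; rewrite -yx.
  by exists U, V; split=> // _ ->.
by exists V, U; split=> //; [exact: xV|rewrite setIC].
Qed.
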